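(* Let $S$ and $T$ be firm semigroups. The following are equivalent. 1. $S$ and $T$ are strongly Morita equivalent. 2. $S$ is isomorphic to a surjectively defined Morita semigroup over $T$.
   Context: Acts: a left $S$-act ${}_SA$ is a set $A$ with a map $S\times A\to A$ satisfying $(st)a=s(ta)$; right acts are defined dually. An $(S,T)$-biact is a left $S$-act and right $T$-act with $(sa)t=s(at)$. Morphisms are maps preserving the actions. A right act $A_S$ is unitary if $AS=A$, a left act ${}_SA$ is unitary if $SA=A$, and a biact is unitary if it is unitary on both sides. For a right $S$-act $A_S$ and a left $S$-act ${}_SB$, the tensor product $A\otimes_S B$ is the quotient of the set $A\times B$ by the smallest equivalence relation identifying $(as,b)$ with $(a,sb)$ for all $a\in A$, $s\in S$, $b\in B$; the class of $(a,b)$ is $a\otimes b$. A semigroup $S$ is firm if the map $S\otimes_S S\to S$, $s\otimes s'\mapsto ss'$, is bijective. A Morita context connecting semigroups $S$ and $T$ is a six-tuple $(S,T,{}_SP_T,{}_TQ_S,\theta,\phi)$, where ${}_SP_T$ is an $(S,T)$-biact, ${}_TQ_S$ is a $(T,S)$-biact, and $\theta:{}_S(P\otimes_T Q)_S\to{}_SS_S$ and $\phi:{}_T(Q\otimes_S P)_T\to{}_TT_T$ are biact morphisms such that $\theta(p\otimes q)p'=p\,\phi(q\otimes p')$ and $q'\theta(p\otimes q)=\phi(q'\otimes p)q$ for all $p,p'\in P$, $q,q'\in Q$. It is unitary if both biacts are unitary and surjective if $\theta$ and $\phi$ are surjective. Semigroups $S$ and $T$ are strongly Morita equivalent if they are connected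 by a unitary surjective Morita context. Let $R$ be a semigroup, ${}_RX$ a left $R$-act, $Y_R$ a right $R$-act and $\langle\,,\rangle:{}_RX\times Y_R\to{}_RR_R$ an $(R,R)$-biact morphism, i.e. $\langle rx,y\rangle=r\langle x,y\rangle$ and $\langle x,yr\rangle=\langle x,y\rangle r$. The Morita semigroup over $R$ defined by $\langle\,,\rangle$ is the set $Y\otimes_R X$ with multiplication $(y\otimes x)(y'\otimes x')=y\otimes\langle x,y'\rangle x'$. It is surjectively defined if $\langle\,,\rangle$ is surjective. *)

(* Defs.v *)
From HB Require Import structures.
From mathcomp Require Import all_boot.
From mathcomp Require Import boolp.
From Stdlib Require Import Relation_Operators.

Set Implicit Arguments.
Unset Strict Implicit.
Unset Printing Implicit Defensive.

Local Open Scope group_scope.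
Local Open Scope quotient_scope.

(* Carriers of semigroups and acts are choice types, as for [semigroupType].
   With the axioms of [boolp] every type carries such a structure, so this is
   no restriction. Semigroups and acts may be empty. *)

Reserved Notation "s *> a" (at level 40, left associativity).
Reserved Notation "a <* s" (at level 40, left associativity).
Reserved Notation "a \ox b" (at level 40, left associativity).

Record lact (S : semigroupType) := LAct {
  lact_sort :> choiceType;
  lact_op : S -> lact_sort -> lact_sort;
  lactA : forall s t a, lact_op (s * t) a = lact_op s (lact_op t a)
}.

Record ract (S : semigroupType) := RAct {
  ract_sort :> choiceType;
  ract_op : ract_sort -> S -> ract_sort;
  ractA : forall a s t, ract_op a (s * t) = ract_op (ract_op a s) t
}.

Notation "s *> a" := (lact_op s a) : group_scope.
Notation "a <* s" := (ract_op a s) : group_scope.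

Record biact (S T : semigroupType) := BiAct {
  biact_sort :> choiceType;
  biact_lop : S -> biact_sort -> biact_sort;
  biact_rop : biact_sort -> T -> biact_sort;
  biact_lA : forall s s' a,
    biact_lop (s * s') a = biact_lop s (biact_lop s' a);
  biact_rA : forall a t t',
    biact_rop a (t * t') = biact_rop (biact_rop a t) t';
  biactA : forall s a t,
    biact_rop (biact_lop s a) t = biact_lop s (biact_rop a t)
}.

Coercion lact_of S T (A : biact S T) : lact S := LAct (@biact_lA S T A).
Coercion ract_of S T (A : biact S T) : ract T := RAct (@biact_rA S T A).
Canonical lact_of.
Canonical ract_of.

Definition lunitary S (A : lact S) := forall a : A, exists s (b : A), a = s *> b.
Definition runitary S (A : ract S) := forall a : A, exists (b : A) s, a = b <* s.
Definition unitary S T (A : biact S T) := lunitary A /\ runitary A.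

Definition surjective (A B : Type) (f : A -> B) := forall b, exists a, f a = b.

Definition biact_morphism S T (A B : biact S T) (f : A -> B) :=
  (forall s (a : A), f (s *> a) = s *> f a) /\
  (forall (a : A) t, f (a <* t) = f a <* t).

Definition regular (S : semigroupType) : biact S S.
Proof.
refine (@BiAct S S S (fun s a => s * a) (fun a s => a * s) _ _ _).
- by move=> s t a; rewrite mulgA.
- by move=> a s t; rewrite mulgA.
- by move=> s a t; rewrite mulgA.
Defined.

Section Tensor.
Context {S : semigroupType} (A : ract S) (B : lact S).

Inductive tensor_step : A * B -> A * B -> Prop :=
  TensorStep a s b : tensor_step (a <* s, b) (a, s *> b).

Definition tensor_rel : rel (A * B) :=
  fun u v => `[< clos_refl_sym_trans _ tensor_step u v >].

Lemma tensor_rel_refl : reflexive tensor_rel.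
Proof. by move=> u; apply/asboolP/rst_refl. Qed.

Lemma tensor_rel_sym : symmetric tensor_rel.
Proof. by move=> u v; apply/asboolP/asboolP; exact: rst_sym. Qed.

Lemma tensor_rel_trans : transitive tensor_rel.
Proof.
by move=> v u w /asboolP uv /asboolP vw; apply/asboolP/(rst_trans _ _ _ _ _ uv vw).
Qed.

Canonical tensor_equiv :=
  EquivRel tensor_rel tensor_rel_refl tensor_rel_sym tensor_rel_trans.

Definition tensor := {eq_quot tensor_equiv}.

Definition tens (a : A) (b : B) : tensor := \pi_tensor (a, b).

Lemma tens_balanced a s b : tens (a <* s) b = tens a (s *> b).
Proof. by apply/eqmodP/asboolP/rst_step. Qed.

Lemma tensP (z : tensor) : exists a b, z = tens a b.
Proof.
by exists (repr z).1, (repr z).2; rewrite /tens -surjective_pairing reprK.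
Qed.

(* Meaningful only for balanced [f], see [tensor_liftE]. *)
Definition tensor_lift (C : Type) (f : A -> B -> C) (z : tensor) : C :=
  f (repr z).1 (repr z).2.

Definition balanced (C : Type) (f : A -> B -> C) :=
  forall a s b, f (a <* s) b = f a (s *> b).

Lemma tensor_liftE (C : Type) (f : A -> B -> C) a b :
  balanced f -> tensor_lift f (tens a b) = f a b.
Proof.
move=> fb; rewrite /tensor_lift.
have /eqmodP/asboolP : repr (tens a b) = (a, b) %[mod tensor] by rewrite reprK.
suff H u v : clos_refl_sym_trans _ tensor_step u v -> f u.1 u.2 = f v.1 v.2.
  by move/H.
by elim=> {u v} [_ _ [x s y]|u|u v _ ->|u v w _ -> _ ->] /=.
Qed.

End Tensor.

Notation "a \ox b" := (tens a b) : group_scope.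

Section TensorBiact.
Context {S T U : semigroupType} (P : biact S T) (Q : biact T U).

Definition tensor_lop (s : S) : tensor P Q -> tensor P Q :=
  tensor_lift (fun (p : P) (q : Q) => (s *> p) \ox q).

Definition tensor_rop (z : tensor P Q) (u : U) : tensor P Q :=
  tensor_lift (fun (p : P) (q : Q) => p \ox (q <* u)) z.

Lemma tensor_lopE s (p : P) (q : Q) : tensor_lop s (p \ox q) = (s *> p) \ox q.
Proof.
apply: tensor_liftE => {}p t {}q; rewrite -tens_balanced /=.
by rewrite biactA.
Qed.

Lemma tensor_ropE (p : P) (q : Q) u : tensor_rop (p \ox q) u = p \ox (q <* u).
Proof.
apply: tensor_liftE => {}p t {}q; rewrite tens_balanced /=.
by rewrite biactA.
Qed.

Definition tensor_biact : biact S U.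
Proof.
refine (@BiAct S U (tensor P Q) tensor_lop tensor_rop _ _ _).
- by move=> s s' z; have [p [q ->]] := tensP z; rewrite !tensor_lopE lactA.
- by move=> z u u'; have [p [q ->]] := tensP z; rewrite !tensor_ropE ractA.
- move=> s z u; have [p [q ->]] := tensP z.
  by rewrite tensor_lopE !tensor_ropE tensor_lopE.
Defined.

End TensorBiact.

Definition tensor_mul (S : semigroupType) :
    tensor (regular S) (regular S) -> S :=
  tensor_lift (A := regular S) (B := regular S) (fun s s' : S => s * s').

Lemma tensor_mulE (S : semigroupType) (s s' : regular S) :
  tensor_mul (s \ox s') = (s : S) * s'.
Proof. by apply: tensor_liftE => a t b /=; rewrite mulgA. Qed.

Definition firm (S : semigroupType) := bijective (@tensor_mul S).

Record morita_context (S T : semigroupType) := MoritaContext {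
  mcP : biact S T;
  mcQ : biact T S;
  mc_theta : tensor_biact mcP mcQ -> regular S;
  mc_phi : tensor_biact mcQ mcP -> regular T;
  mc_theta_morphism : biact_morphism mc_theta;
  mc_phi_morphism : biact_morphism mc_phi;
  mc_thetaP : forall (p p' : mcP) (q : mcQ),
    mc_theta (p \ox q) *> p' = p <* mc_phi (q \ox p');
  mc_thetaQ : forall (p : mcP) (q q' : mcQ),
    q' <* mc_theta (p \ox q) = mc_phi (q' \ox p) *> q
}.

Definition unitary_context S T (C : morita_context S T) :=
  unitary (mcP C) /\ unitary (mcQ C).

Definition surjective_context S T (C : morita_context S T) :=
  surjective (@mc_theta S T C) /\ surjective (@mc_phi S T C).

Definition strongly_morita_equivalent (S T : semigroupType) :=
  exists C : morita_context S T, unitary_context C /\ surjective_context C.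

Record pairing (R : semigroupType) (X : lact R) (Y : ract R) := Pairing {
  pairing_fun :> X -> Y -> R;
  pairingl : forall r x y, pairing_fun (r *> x) y = r * pairing_fun x y;
  pairingr : forall x y r, pairing_fun x (y <* r) = pairing_fun x y * r
}.

Definition pairing_surjective R (X : lact R) (Y : ract R)
    (br : pairing X Y) :=
  surjective (fun xy : X * Y => br xy.1 xy.2).

(* The carrier does not depend on the pairing; the argument lets the
   multiplication be inferred from the type. *)
Definition morita_semigroup (R : semigroupType) (X : lact R) (Y : ract R)
    (br : pairing X Y) : Type :=
  tensor Y X.

Section MoritaSemigroup.
Context {R : semigroupType} {X : lact R} {Y : ract R} (br : pairing X Y).
Local Notation M := (morita_semigroup br).

HB.instance Definition _ := Choice.copy M (tensor Y X).

Definition morita_mul (z z' : M) : M :=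
  tensor_lift (fun y x =>
    tensor_lift (fun y' x' => y \ox (br x y' *> x')) z') z.

Lemma morita_mulE y x y' x' :
  morita_mul (y \ox x) (y' \ox x') = y \ox (br x y' *> x').
Proof.
have bal v u : balanced (fun y' x' => v \ox (br u y' *> x')).
  by move=> a r b; rewrite pairingr lactA.
rewrite /morita_mul tensor_liftE ?tensor_liftE // => a r b.
by rewrite !tensor_liftE // pairingl lactA tens_balanced.
Qed.

Lemma morita_mulA : associative morita_mul.
Proof.
move=> z z' z''.
have [y [x ->]] := tensP z; have [y' [x' ->]] := tensP z'.
have [y'' [x'' ->]] := tensP z''.
by rewrite !morita_mulE pairingl lactA.
Qed.

HB.instance Definition _ := isSemigroup.Build M morita_mulA.

Lemma morita_semigroupE y x y' x' :
  (y \ox x : M) * (y' \ox x' : M) =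
  y \ox (br x y' *> x').
Proof. exact: morita_mulE. Qed.

End MoritaSemigroup.

Definition isomorphic (S S' : semigroupType) :=
  exists f : {multiplicative S -> S'}, bijective f.

(* Main.v *)
(* A unitary surjective context gives the pairing [q, p |-> phi (q \ox p)], and
   [theta] is a homomorphism from its Morita semigroup [P \ox Q] onto [S]. It is
   injective because [theta z *> w = z <* theta w]: the map
   [theta z \ox s |-> z <* s] is well defined on [S \ox S], which is [S].
   Conversely, if [S] is the Morita semigroup [Y \ox X], then [S] acts on [Y] and
   [X], and the unitary biacts [Y \ox T] and [T \ox X] form a context whose maps
   are induced by the identity of [Y \ox X] and by the pairing. *)
Require Import Defs.
From HB Require Import structures.
From mathcomp Require Import all_boot.
From mathcomp Require Import boolp.

Set Implicit Arguments.
Unset Strict Implicit.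
Unset Printing Implicit Defensive.

Local Open Scope group_scope.

(** This is surjectivity of [tensor_mul], read on a representative of the tensor. *)
Lemma firm_factor (S : semigroupType) : firm S ->
  forall s : S, exists s1 s2, s = s1 * s2.
Proof.
case=> g _ gK s; have [s1 [s2 E]] := tensP (g s).
by exists s1, s2; rewrite -(gK s) E tensor_mulE.
Qed.

(** * From a Morita context to a Morita semigroup *)

Section ContextToMorita.
Variables (S T : semigroupType) (C : morita_context S T).
Local Notation PQ := (tensor_biact (mcP C) (mcQ C)).
Local Notation theta := (@mc_theta S T C).
Local Notation phi := (@mc_phi S T C).

(** On pure tensors, the two compatibility laws turn this into moving [phi (q \ox p')] across the
    tensor sign between [p] and [q']. *)
Lemma mc_theta_swap (z w : PQ) : theta z *> w = z <* theta w.
Proof.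
have [p [q ->]] := tensP z; have [p' [q' ->]] := tensP w.
rewrite /= tensor_lopE tensor_ropE mc_thetaP mc_thetaQ.
exact: tens_balanced.
Qed.

Lemma mc_theta_inj : firm S -> runitary (mcQ C) -> surjective theta ->
  injective theta.
Proof.
move=> [g mulK _] unitQ /choice[h hK] z z' Ezz'.
have [thl thr] := @mc_theta_morphism S T C.
(* The right-hand side does not mention the section [h] of [theta], so the choice of preimages is
   harmless. *)
have hE (s : S) (w : PQ) : h s <* theta w = s *> w.
  by rewrite -mc_theta_swap hK.
pose k (s s' : regular S) : PQ := h s <* s'.
have k_bal : balanced (A := regular S) (B := regular S) k.
  (* With [s'] written as [theta (h s')], both sides become the action of [s * t] on [h s']. *)
  move=> s t s'; rewrite /k -(hK s') -thl !hE; exact: lactA.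
have factor (w : PQ) : exists (w1 : PQ) (s : S), w = w1 <* s.
  have [p [q ->]] := tensP w; have [q1 [s ->]] := unitQ q.
  by exists (p \ox q1), s; rewrite /= tensor_ropE.
have kE (w : PQ) s : k (theta w) s = w <* s.
  by rewrite /k -(hK s) hE mc_theta_swap.
(* Now [theta w * s = theta w' * s'], so by firmness the tensors [theta w \ox s] and
   [theta w' \ox s'] agree; the map induced by [k] sends them to [z] and [z']. *)
have [w [s Ez]] := factor z; have [w' [s' Ez']] := factor z'.
rewrite Ez Ez' -!kE.
rewrite -(tensor_liftE (B := regular S) (theta w) s k_bal).
rewrite -(tensor_liftE (B := regular S) (theta w') s' k_bal).
congr tensor_lift; apply: (can_inj mulK).
by rewrite !tensor_mulE; move: Ezz'; rewrite Ez Ez' !thr.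
Qed.

Lemma mc_phi_pairingl (t : T) (q : mcQ C) (p : mcP C) :
  phi ((t *> q) \ox p) = t * phi (q \ox p) :> T.
Proof.
have [phl _] := @mc_phi_morphism S T C.
by rewrite -[RHS](phl t (q \ox p)) /= tensor_lopE.
Qed.

Lemma mc_phi_pairingr (q : mcQ C) (p : mcP C) (t : T) :
  phi (q \ox (p <* t)) = phi (q \ox p) * t :> T.
Proof.
have [_ phr] := @mc_phi_morphism S T C.
by rewrite -[RHS](phr (q \ox p) t) /= tensor_ropE.
Qed.

Definition context_pairing : pairing (mcQ C) (mcP C) :=
  Pairing (pairing_fun := fun (q : mcQ C) (p : mcP C) => phi (q \ox p))
    mc_phi_pairingl mc_phi_pairingr.

(** The product [p \ox (phi (q \ox p') *> q')] equals [p \ox (q <* theta (p' \ox q'))], and [theta]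
    respects the right action. *)
Lemma mc_thetaM (z w : morita_semigroup context_pairing) :
  theta (z * w) = theta z * theta w :> S.
Proof.
have [_ thr] := @mc_theta_morphism S T C.
have [p [q ->]] := tensP z; have [p' [q' ->]] := tensP w.
rewrite morita_semigroupE /= -mc_thetaQ.
by rewrite -[RHS](thr (p \ox q) (theta (p' \ox q'))) /= tensor_ropE.
Qed.

Lemma context_isomorphic : firm S -> runitary (mcQ C) -> surjective theta ->
  isomorphic S (morita_semigroup context_pairing).
Proof.
move=> firmS unitQ surj; have inj := mc_theta_inj firmS unitQ surj.
(* A section of the injective [theta] is its inverse, and it inherits multiplicativity from
   [theta]. *)
have [g gK] := choice surj.
pose g' : S -> morita_semigroup context_pairing := g.
have gM : {morph g' : x y / x * y}.
  by move=> s t; apply: inj; rewrite mc_thetaM !gK.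
exists (HB.pack_for {multiplicative S -> morita_semigroup context_pairing}
          g' (isMultiplicative.Build _ _ g' gM)).
exists theta => //= z; apply: inj; exact: gK.
Qed.

End ContextToMorita.

(** * Actions of a Morita semigroup on [Y] and [X] *)

Section MoritaToContext.
Variables (S T : semigroupType) (X : lact T) (Y : ract T) (br : pairing X Y).
Local Notation M := (morita_semigroup br).

Definition morita_lact (z : M) (y : Y) : Y :=
  tensor_lift (fun y' x => y' <* br x y) z.

Definition morita_ract (x : X) (z : M) : X :=
  tensor_lift (fun y x' => br x y *> x') z.

Lemma morita_lactE (y' : Y) (x : X) y :
  morita_lact (y' \ox x) y = y' <* br x y.
Proof. by apply: tensor_liftE => a t b; rewrite pairingl ractA. Qed.

Lemma morita_ractE x (y : Y) (x' : X) :
  morita_ract x (y \ox x') = br x y *> x'.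
Proof. by apply: tensor_liftE => a t b; rewrite pairingr lactA. Qed.

Lemma morita_lactM z z' y :
  morita_lact (z * z') y = morita_lact z (morita_lact z' y).
Proof.
have [a [b ->]] := tensP z; have [a' [b' ->]] := tensP z'.
by rewrite morita_semigroupE !morita_lactE pairingl pairingr ractA.
Qed.

Lemma morita_ractM x z z' :
  morita_ract x (z * z') = morita_ract (morita_ract x z) z'.
Proof.
have [a [b ->]] := tensP z; have [a' [b' ->]] := tensP z'.
by rewrite morita_semigroupE !morita_ractE pairingl lactA.
Qed.

Lemma morita_lact_ract z y t :
  morita_lact z y <* t = morita_lact z (y <* t).
Proof. by have [a [b ->]] := tensP z; rewrite !morita_lactE pairingr ractA. Qed.

Lemma morita_ract_lact t x z :
  morita_ract (t *> x) z = t *> morita_ract x z.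
Proof. by have [a [b ->]] := tensP z; rewrite !morita_ractE pairingl lactA. Qed.

(** For [z = a \ox b] both sides are [br x a * br b y]. This balancedness over the Morita semigroup
    lets the pairing descend to a tensor product over [S]. *)
Lemma br_morita x z y : br (morita_ract x z) y = br x (morita_lact z y).
Proof.
by have [a [b ->]] := tensP z; rewrite morita_ractE morita_lactE pairingl pairingr.
Qed.

Lemma morita_mul_tensl (z : M) (y : Y) (x : X) :
  z * (y \ox x : M) = morita_lact z y \ox x.
Proof.
have [a [b ->]] := tensP z.
by rewrite morita_semigroupE morita_lactE tens_balanced.
Qed.

Lemma morita_mul_tensr (y : Y) (x : X) (z : M) :
  (y \ox x : M) * z = y \ox morita_ract x z.
Proof.
by have [a [b ->]] := tensP z; rewrite morita_semigroupE morita_ractE.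
Qed.

(** * The Morita context on [Y \ox T] and [T \ox X] *)

Variables (f : {multiplicative S -> M}) (g : M -> S).
Hypotheses (fK : cancel f g) (gK : cancel g f).

Definition Y_biact : biact S T.
Proof.
refine (@BiAct S T Y (fun s y => morita_lact (f s) y) (fun y t => y <* t) _ _ _).
- by move=> s s' y; rewrite gmulfM morita_lactM.
- exact: ractA.
- by move=> s y t; rewrite morita_lact_ract.
Defined.

Definition X_biact : biact T S.
Proof.
refine (@BiAct T S X (fun t x => t *> x) (fun x s => morita_ract x (f s)) _ _ _).
- exact: lactA.
- by move=> x s s'; rewrite gmulfM morita_ractM.
- by move=> t x s; rewrite morita_ract_lact.
Defined.

(** [Y] and [X] are not assumed unitary over [T]; tensoring with [T] makes them so once every
    element of [T] factors. *)
Definition YT : biact S T := tensor_biact Y_biact (regular T).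
Definition TX : biact T S := tensor_biact (regular T) X_biact.

Definition YT_mul : YT -> Y :=
  tensor_lift (A := Y_biact) (B := regular T) (fun y t => y <* t : Y_biact).

Definition TX_mul : TX -> X :=
  tensor_lift (A := regular T) (B := X_biact) (fun t x => t *> x : X_biact).

Lemma YT_mulE (y : Y_biact) (t : regular T) :
  YT_mul (y \ox t) = (y : Y) <* (t : T).
Proof. by apply: tensor_liftE => a u b /=; rewrite ractA. Qed.

Lemma TX_mulE (t : regular T) (x : X_biact) :
  TX_mul (t \ox x) = (t : T) *> (x : X).
Proof. by apply: tensor_liftE => a u b /=; rewrite lactA. Qed.

Lemma YT_mull s (p : YT) : YT_mul (s *> p) = morita_lact (f s) (YT_mul p).
Proof.
have [y [t ->]] := tensP p.
by rewrite /= tensor_lopE !YT_mulE morita_lact_ract.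
Qed.

Lemma YT_mulr (p : YT) t : YT_mul (p <* t) = YT_mul p <* t.
Proof.
by have [y [u ->]] := tensP p; rewrite /= tensor_ropE !YT_mulE /= ractA.
Qed.

Lemma TX_mull t (q : TX) : TX_mul (t *> q) = t *> TX_mul q.
Proof.
by have [u [x ->]] := tensP q; rewrite /= tensor_lopE !TX_mulE /= lactA.
Qed.

Lemma TX_mulr (q : TX) s : TX_mul (q <* s) = morita_ract (TX_mul q) (f s).
Proof.
have [t [x ->]] := tensP q.
by rewrite /= tensor_ropE !TX_mulE morita_ract_lact.
Qed.

Definition theta_of (z : tensor_biact YT TX) : regular S :=
  g (tensor_lift (fun (p : YT) (q : TX) => YT_mul p \ox TX_mul q) z).

Definition phi_of (z : tensor_biact TX YT) : regular T :=
  tensor_lift (fun (q : TX) (p : YT) => br (TX_mul q) (YT_mul p)) z.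

Lemma theta_ofE (p : YT) (q : TX) :
  theta_of (p \ox q) = g (YT_mul p \ox TX_mul q).
Proof.
congr g; apply: tensor_liftE => a t b.
by rewrite YT_mulr TX_mull tens_balanced.
Qed.

Lemma phi_ofE (q : TX) (p : YT) : phi_of (q \ox p) = br (TX_mul q) (YT_mul p).
Proof.
by apply: tensor_liftE => a s b; rewrite YT_mull TX_mulr br_morita.
Qed.

Lemma theta_of_morphism : biact_morphism theta_of.
Proof.
split=> [s z|z s]; have [p [q ->]] := tensP z; apply: (can_inj fK).
  rewrite /= tensor_lopE !theta_ofE gmulfM !gK YT_mull.
  by rewrite morita_mul_tensl.
rewrite /= tensor_ropE !theta_ofE gmulfM !gK TX_mulr.
by rewrite morita_mul_tensr.
Qed.

Lemma phi_of_morphism : biact_morphism phi_of.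
Proof.
split=> [t z|z t]; have [q [p ->]] := tensP z.
  by rewrite /= tensor_lopE !phi_ofE TX_mull pairingl.
by rewrite /= tensor_ropE !phi_ofE YT_mulr pairingr.
Qed.

(** With [p = y \ox t], [p' = y' \ox t'] and [x = TX_mul q], the two sides differ by moving
    [t * br x y'] across the tensor sign. *)
Lemma theta_ofP (p p' : YT) (q : TX) :
  theta_of (p \ox q) *> p' = p <* phi_of (q \ox p').
Proof.
rewrite theta_ofE phi_ofE.
have [y [t ->]] := tensP p; have [y' [t' ->]] := tensP p'.
rewrite /= tensor_lopE tensor_ropE /= gK !YT_mulE morita_lactE pairingr mulgA.
rewrite -ractA.
exact: (tens_balanced (A := Y_biact) (B := regular T)).
Qed.

Lemma theta_ofQ (p : YT) (q q' : TX) :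
  q' <* theta_of (p \ox q) = phi_of (q' \ox p) *> q.
Proof.
rewrite theta_ofE phi_ofE.
have [t [x ->]] := tensP q; have [t' [x' ->]] := tensP q'.
rewrite /= tensor_lopE tensor_ropE /= gK !TX_mulE morita_ractE pairingl -mulgA.
rewrite -lactA.
by rewrite -(tens_balanced (A := regular T) (B := X_biact)) /= mulgA.
Qed.

Definition context_of : morita_context S T :=
  MoritaContext theta_of_morphism phi_of_morphism theta_ofP theta_ofQ.

(** * Unitarity and surjectivity of the context *)

Hypotheses (factS : forall s : S, exists s1 s2, s = s1 * s2)
  (factT : forall t : T, exists t1 t2, t = t1 * t2)
  (br_surj : pairing_surjective br).

Lemma context_of_unitary : unitary_context context_of.
Proof.
split; split=> z.
- have [y [t ->]] := tensP z; have [t1 [t2 ->]] := factT t.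
  (* Once [t1 = br x y'], it moves to the left, and [y <* br x y'] is the action of [y \ox x] on
     [y']. *)
  have [[x y'] /= <-] := br_surj t1.
  exists (g ((y : Y) \ox x)), ((y' : Y_biact) \ox (t2 : regular T)).
  rewrite /= tensor_lopE /= gK morita_lactE.
  exact/esym/(tens_balanced (A := Y_biact) (B := regular T)).
- have [y [t ->]] := tensP z; have [t1 [t2 ->]] := factT t.
  by exists (y \ox (t1 : regular T)), t2; rewrite /= tensor_ropE.
- have [t [x ->]] := tensP z; have [t1 [t2 ->]] := factT t.
  by exists t1, ((t2 : regular T) \ox x); rewrite /= tensor_lopE.
- have [t [x ->]] := tensP z; have [t1 [t2 ->]] := factT t.
  have [[x' y] /= <-] := br_surj t2.
  exists ((t1 : regular T) \ox (x' : X_biact)), (g (y \ox (x : X))).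
  rewrite /= tensor_ropE /= gK morita_ractE.
  exact: (tens_balanced (A := regular T) (B := X_biact)).
Qed.

Lemma context_of_surjective : surjective_context context_of.
Proof.
split=> [s|t].
  (* Factoring [s] puts a bracket inside [f s = y \ox (br x y' *> x')]; splitting that bracket as
     [t1 * t2] gives [(y <* t1) \ox (t2 *> x')], which has the form of a value of [theta_of]. *)
  have [s1 [s2 Es]] := factS s.
  have [y [x E1]] := tensP (f s1); have [y' [x' E2]] := tensP (f s2).
  have [t1 [t2 Et]] := factT (br x y').
  exists (((y : Y_biact) \ox (t1 : regular T) : YT) \ox
          ((t2 : regular T) \ox (x' : X_biact) : TX)).
  rewrite /= theta_ofE; apply: (can_inj fK).
  rewrite gK YT_mulE TX_mulE Es gmulfM E1 E2 morita_semigroupE Et.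
  by rewrite tens_balanced lactA.
(* Three factors are taken: the middle one becomes [br x y], and the outer ones are absorbed as
   [t1 *> x] and [y <* t3]. *)
have [u [t3 ->]] := factT t; have [t1 [t2 ->]] := factT u.
have [[x y] /= <-] := br_surj t2.
exists (((t1 : regular T) \ox (x : X_biact) : TX) \ox
        ((y : Y_biact) \ox (t3 : regular T) : YT)).
by rewrite /= phi_ofE TX_mulE YT_mulE pairingl pairingr mulgA.
Qed.

End MoritaToContext.

Theorem theorem2p11 (S T : semigroupType) (firmS : firm S) (firmT : firm T) :
  strongly_morita_equivalent S T <->
  exists (X : lact T) (Y : ract T) (br : pairing X Y),
    pairing_surjective br /\ isomorphic S (morita_semigroup br).
Proof.
split=> [[C [[_ [_ unitQ]] [th_surj ph_surj]]]|].
  exists (mcQ C), (mcP C), (context_pairing C); split.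
    move=> t; have [z <-] := ph_surj t; have [q [p ->]] := tensP z.
    by exists (q, p).
  exact: context_isomorphic.
move=> [X [Y [br [br_surj [f [g fK gK]]]]]].
exists (context_of fK gK); split.
  exact: context_of_unitary (firm_factor firmT) br_surj.
exact: context_of_surjective (firm_factor firmS) (firm_factor firmT) br_surj.
Qed.
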